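(* Let $S$ be a countably infinite set, let $R=(R(u,v))_{u,v\in S}$ be a stochastic matrix that is irreducible, aperiodic, positive recurrent with stationary distribution $\pi=(\pi_v)_{v\in S}$, and uniformly ergodic. Let $U_0=(U_{0,v})_{v\in S}\in[0,\infty)^S$ be a non-random vector with $t:=\sum_{v\in S}U_{0,v}\in(0,\infty)$, and let $(U_n)_{n\ge 0}$ be the urn process with color set $S$, replacement matrix $R$ and initial configuration $U_0$, with sequence of drawn colors $(Z_n)_{n\ge 0}$. Then: (i) As $n\to\infty$, $$\frac{U_n}{n+t}\longrightarrow \pi \quad\text{almost surely},$$ where the convergence holds coordinatewise and also in $\ell_1(S)$. (ii) For $v\in S$ let $N_{n,v}:=\sum_{k=0}^n \mathbf 1_{\{Z_k=v\}}$ be the number of times the color $v$ is chosen up to time $n$. Then, as $n\to\infty$, $$\frac{N_{n,v}}{n+1}\longrightarrow \pi_v\quad\text{almost surely},$$ where the convergence holds coordinatewise (for every $v\in S$) and also in $\ell_1(S)$, i.e. $\sum_{v\in S}\left|\frac{N_{n,v}}{n+1}-\pi_v\right|\to 0$ almost surely.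
   Context: Urn process: given a stochastic matrix $R$ on $S$ (nonnegative entries, each row summing to $1$) and a non-random nonnegative vector $U_0\in\ell_1(S)$ of total mass $t\in(0,\infty)$, the $S$-valued random variables $(Z_n)_{n\ge0}$ and the random vectors $U_n=(U_{n,v})_{v\in S}\in[0,\infty)^S\cap \ell_1(S)$ are defined recursively by $$\mathbb P\left(Z_n=z\mid \text{past}\right)=\frac{U_{n,z}}{n+t}\quad (z\in S),\qquad U_{n+1}=U_n+R_{Z_n},$$ where $R_z=(R(z,v))_{v\in S}$ is the $z$-th row of $R$ and the ''past'' is the history $U_0,Z_0,U_1,Z_1,\dots,Z_{n-1},U_n$. (The total mass of $U_n$ is $n+t$.) Stationary distribution: the unique probability vector $\pi$ on $S$ with $\pi R=\pi$. Uniformly ergodic: there exist constants $0<\rho<1$ and $C>0$ such that $|R^n(u,v)-\pi_v|\le C\rho^n$ for all $n\ge1$ and all $u,v\in S$, where $R^n$ is the $n$-th power of $R$. (No summation over $v$ is involved.) *)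

(* Defs.v *)
From HB Require Import structures.
From mathcomp Require Import all_boot all_order all_algebra.
From mathcomp Require Import all_classical all_reals all_analysis.
Set Implicit Arguments.
Unset Strict Implicit.
Unset Printing Implicit Defensive.
Import Order.TTheory GRing.Theory Num.Theory.
Import numFieldNormedType.Exports.
Local Open Scope classical_set_scope.
Local Open Scope ring_scope.

Section InfiniteMatrices.
Context {K : realType} {S : countType}.
Implicit Types (A B R : S -> S -> K) (p x : S -> K).

Definition probability_vector p : Prop :=
  (forall v, 0 <= p v) /\ (\esum_(v in [set: S]) (p v)%:E = 1)%E.

Definition stochastic R : Prop := forall u, probability_vector (R u).

(* [esum] is meant for nonnegative families, and [fine] loses nothing when the
   sums are finite; both hold for the powers of a stochastic matrix. *)
Definition smul A B : S -> S -> K :=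
  fun u v => fine (\esum_(w in [set: S]) (A u w * B w v)%:E)%E.

Fixpoint spow R (n : nat) : S -> S -> K :=
  if n is m.+1 then smul R (spow R m) else fun u v => (u == v)%:R.

Definition irreducible R : Prop := forall u v, exists n, 0 < spow R n u v.

(* gcd {n >= 1 | R^n(u,u) > 0} = 1 *)
Definition aperiodic R : Prop := forall (u : S) (d : nat),
  (forall n, (0 < n)%N -> 0 < spow R n u u -> (d %| n)%N) -> d = 1%N.

(* The probability that the chain started at u enters v, at a time >= 1, for
   the first time at time n + 1 (first-step decomposition). *)
Fixpoint first_passage R (n : nat) : S -> S -> K :=
  if n is m.+1 then
    fun u v => fine (\esum_(w in [set~ v]) (R u w * first_passage R m w v)%:E)%E
  else R.

(* The return time to u is almost surely finite and has finite mean. *)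
Definition positive_recurrent R : Prop := forall u,
  (\sum_(0 <= n <oo) (first_passage R n u u)%:E = 1)%E /\
  (\sum_(0 <= n <oo) (n.+1%:R * first_passage R n u u)%:E < +oo)%E.

Definition stationary R p : Prop := probability_vector p /\
  forall v, (\esum_(u in [set: S]) (p u * R u v)%:E = (p v)%:E)%E.

Definition uniformly_ergodic R p : Prop := exists rho C : K,
  [/\ 0 < rho, rho < 1, 0 < C &
   forall n u v, (1 <= n)%N -> `|spow R n u v - p v| <= C * rho ^+ n].

Definition cvg_coordinatewise (y : nat -> S -> K) x : Prop :=
  forall v, y n v @[n --> \oo] --> x v.

Definition cvg_l1 (y : nat -> S -> K) x : Prop :=
  (\esum_(v in [set: S]) `|y n v - x v|%:E)%E @[n --> \oo] --> 0%E.

End InfiniteMatrices.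

Section Urn.
Context {K : realType} {S : countType} {d : measure_display}
  {Omega : measurableType d}.
Implicit Types (P : probability Omega K).

(* f is a version of the conditional probability of E given the
   sigma-algebra G. *)
Definition is_cond_prob P (G : set (set Omega)) (E : set Omega)
    (f : Omega -> K) : Prop :=
  [/\ (forall B : set K, measurable B -> G (f @^-1` B)),
      P.-integrable [set: Omega] (EFin \o f) &
      forall A, G A -> (\int[P]_(w in A) (f w)%:E = P (A `&` E))%E].

(* The sigma-algebra generated by U_0, Z_0, U_1, Z_1, ..., Z_(n-1), U_n. *)
Definition urn_past (U : nat -> Omega -> S -> K) (Z : nat -> Omega -> S)
    (n : nat) : set (set Omega) :=
  <<s [set E | (exists k (A : set S), (k < n)%N /\ E = Z k @^-1` A) \/
               (exists k v (B : set K), [/\ (k <= n)%N, measurable B &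
                  E = (fun w => U k w v) @^-1` B])] >>.

Record urn_process P (R : S -> S -> K) (U0 : S -> K) (t : K)
    (U : nat -> Omega -> S -> K) (Z : nat -> Omega -> S) : Prop := {
  urn_draw_measurable : forall n (A : set S), measurable (Z n @^-1` A) ;
  urn_init : forall w v, U 0%N w v = U0 v ;
  urn_step : forall n w v, U n.+1 w v = U n w v + R (Z n w) v ;
  urn_draw : forall n z,
    is_cond_prob P (urn_past U Z n) (Z n @^-1` [set z])
      (fun w => U n w z / (n%:R + t)) }.

Definition num_draws (Z : nat -> Omega -> S) (n : nat) (w : Omega) (v : S)
  : nat := (\sum_(0 <= k < n.+1) (Z k w == v))%N.

End Urn.

(* Main.v *)
Require Import Defs.
From HB Require Import structures.
From mathcomp Require Import all_boot all_order all_algebra.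
From mathcomp Require Import all_classical all_reals all_analysis.
From mathcomp Require Import measurable_realfun ring lra zify.
Import Order.TTheory GRing.Theory Num.Theory.
Import numFieldNormedType.Exports.
Local Open Scope classical_set_scope.
Local Open Scope ring_scope.

(** Test the configuration against functions. For f : S -> [0, 1] let
    <U_n, f> = \sum_v U_n(v) f(v), and write R f for u |-> <R_u, f>. Adding the
    row R_(Z_n) to the urn gives <U_(n+1), f> = <U_n, f> + (R f)(Z_n), so that
    <U_n, f> is a constant plus the sum of the (R f)(Z_j), j < n. On the other
    hand a_j(g) := <U_j, g> / (j + t) is the conditional mean of g(Z_j) given
    the past. If the draw errors g(Z_j) - a_j(g) average to 0, then with g = R f
    the sequence a_n(f) is asymptotically the Cesaro mean of a_j(R f), j < n
    ([cvg0_sub_mean]).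

    Iterate this from f = 1_v, so that the k-th function is u |-> R^k(u, v):
    a_n(1_v) = U_n(v) / (n + t) is asymptotically a k-fold Cesaro mean of the
    sequence a_j(R^k(., v)). By uniform ergodicity R^k(., v) is within C rho^k
    of the constant pi_v, and so is its average against any probability vector;
    Cesaro means preserve this bound, and k is arbitrary. Hence
    U_n(v) / (n + t) --> pi_v ([cvg0_mean_chain], [urn_config_cvg]). No rate of
    convergence in n enters, only the uniformity in u of the ergodic estimate.

    The draw errors of f are bounded by 1, and each is uncorrelated with the sum
    of the previous ones ([draw_error_uncorrelated]), so that the strong law
    [strong_law_bounded_uncorrelated] applies; there are only countably many
    pairs (v, k), hence almost surely it holds for all of them. As S is
    countable, the draws Z_0, ..., Z_(n-1) take countably many values and
    determine U_0, ..., U_n: conditional expectations are computed on the atoms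
    of this discrete history.

    For the draws, N_(n,v) / (n + 1) is the mean of the draw errors of 1_v plus
    the mean of the U_j(v) / (j + t), which tends to pi_v. In both cases all
    vectors have total mass 1, so coordinatewise convergence implies convergence
    in l1 ([scheffe]). *)

(** * Nonnegative vectors of finite mass *)

Section Pairing.
Context {K : realType} {S : countType}.
Implicit Types (p q f : S -> K) (m : K).

Lemma ge0_esumZl (I : set S) (a : S -> \bar K) (c : K) : 0 <= c ->
  (forall i, 0 <= a i)%E ->
  (\esum_(i in I) (c%:E * a i) = c%:E * \esum_(i in I) a i)%E.
Proof.
move=> c0 a0.
have le b (r : K) : 0 <= r -> (forall i, 0 <= b i)%E ->
    (\esum_(i in I) (r%:E * b i) <= r%:E * \esum_(i in I) b i)%E.
  move=> r0 b0; apply: ge_ereal_sup => _ [X [finX XI]] <-.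
  rewrite -ge0_mule_fsumr//; apply: lee_wpmul2l; rewrite ?lee_fin//.
  by apply: ereal_sup_ubound; exists X.
apply/eqP; rewrite eq_le le//=.
have [->|cn0] := eqVneq c 0.
  by rewrite mul0e esum_ge0// => i _; rewrite mul0e.
have {cn0}c0 : 0 < c by rewrite lt_neqAle eq_sym cn0.
rewrite -lee_pdivlMl//; apply: le_trans (le _ _ _ _); last first.
- by move=> i; rewrite mule_ge0// lee_fin ltW.
- by rewrite invr_ge0 ltW.
by apply: le_esum => i _; rewrite muleA -EFinM mulVf ?gt_eqF// mul1e.
Qed.

Definition has_mass p m :=
  (forall v, 0 <= p v) /\ (\esum_(v in [set: S]) (p v)%:E = m%:E)%E.

(** With this definition [spow R k.+1 u v] is convertible to
    [dot (R u) (spow R k ^~ v)]. *)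
Definition dot p f : K := fine (\esum_(v in [set: S]) (p v * f v)%:E)%E.

Lemma EFin_dot {p m f} : has_mass p m -> (forall v, 0 <= f v <= 1) ->
  (\esum_(v in [set: S]) (p v * f v)%:E = (dot p f)%:E)%E.
Proof.
move=> [p0 pm] f01; rewrite fineK// ge0_fin_numE.
  apply: le_lt_trans (ltry m); rewrite -pm; apply: le_esum => v _.
  by rewrite lee_fin ler_piMr//; case/andP: (f01 v).
apply: esum_ge0 => v _; rewrite lee_fin mulr_ge0//.
by case/andP: (f01 v).
Qed.

Lemma dot_ge0_le {p m f} : has_mass p m -> (forall v, 0 <= f v <= 1) ->
  0 <= dot p f <= m.
Proof.
move=> pm f01; rewrite -!lee_fin -(EFin_dot pm f01) -pm.2.
rewrite esum_ge0/=; last first.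
  by move=> v _; rewrite lee_fin mulr_ge0 ?pm.1//; case/andP: (f01 v).
apply: le_esum => v _.
by rewrite lee_fin ler_piMr ?pm.1//; case/andP: (f01 v).
Qed.

Lemma has_massD {p q m l} : has_mass p m -> has_mass q l ->
  has_mass (fun v => p v + q v) (m + l).
Proof.
move=> [p0 pm] [q0 ql]; split; first by move=> v; rewrite addr_ge0.
by rewrite EFinD -pm -ql -esumD// => v _; rewrite lee_fin.
Qed.

Lemma has_mass_divr {p m c} : 0 <= c -> has_mass p m ->
  has_mass (fun v => p v / c) (m / c).
Proof.
move=> c0 [p0 pm]; split; first by move=> v; rewrite divr_ge0.
rewrite mulrC EFinM -pm -ge0_esumZl ?invr_ge0//.
by apply: eq_esum => v _; rewrite mulrC EFinM.
Qed.

Lemma has_mass_dirac z : has_mass (fun v => (z == v)%:R) 1.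
Proof.
split=> [v|]; first by rewrite ler0n.
rewrite -(@esum_set1 K S z (fun=> 1%E))// [RHS]esum_mkcond.
by apply: eq_esum => v _; rewrite in_set1 eq_sym; case: (_ == _).
Qed.

Lemma has_mass_sum {q : nat -> S -> K} {l : nat -> K} n :
  (forall j, has_mass (q j) (l j)) ->
  has_mass (fun v => \sum_(0 <= j < n) q j v) (\sum_(0 <= j < n) l j).
Proof.
move=> ql; elim: n => [|n IH].
  by split=> [v|]; rewrite ?esum1// => *; rewrite big_nil.
have := has_massD IH (ql n); rewrite big_nat_recr//=.
by congr has_mass; apply/funext => v; rewrite big_nat_recr.
Qed.

Lemma dotD {p q m l f} : has_mass p m -> has_mass q l ->
  (forall v, 0 <= f v <= 1) ->
  dot (fun v => p v + q v) f = dot p f + dot q f.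
Proof.
move=> pm ql f01; apply: EFin_inj; rewrite EFinD.
rewrite -(EFin_dot (has_massD pm ql) f01).
rewrite -(EFin_dot pm f01) -(EFin_dot ql f01) -esumD.
- by apply: eq_esum => v _; rewrite mulrDl EFinD.
- by move=> v _; rewrite lee_fin mulr_ge0 ?pm.1//; case/andP: (f01 v).
- by move=> v _; rewrite lee_fin mulr_ge0 ?ql.1//; case/andP: (f01 v).
Qed.

Lemma dot_dirac {p} v : (forall u, 0 <= p u) -> dot p (fun u => (u == v)%:R) = p v.
Proof.
move=> p0; rewrite /dot -[RHS]/(fine (p v)%:E) -(@esum_set1 K S v (fun u => (p u)%:E)).
  congr fine; rewrite [RHS]esum_mkcond; apply: eq_esum => u _.
  by rewrite in_set1; case: (_ == _); rewrite ?mulr1 ?mulr0.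
by rewrite lee_fin.
Qed.

Lemma dot_dist {p f m} {c e : K} :
  has_mass p m -> (forall v, 0 <= f v <= 1) -> 0 <= c -> 0 <= e ->
  (forall v, `|f v - c| <= e) -> `|dot p f - m * c| <= m * e.
Proof.
move=> pm f01 c0 e0 fce; have p0 := pm.1.
have f0 v : 0 <= f v by case/andP: (f01 v).
have massZ r : 0 <= r -> (\esum_(v in [set: S]) (p v * r)%:E = (m * r)%:E)%E.
  move=> r0; rewrite mulrC EFinM -pm.2 -ge0_esumZl//.
  by apply: eq_esum => v _; rewrite mulrC EFinM.
have pf v : 0 <= p v * f v by rewrite mulr_ge0.
have pr v r : 0 <= r -> 0 <= p v * r by move=> ?; rewrite mulr_ge0.
rewrite ler_distl; apply/andP; split.
  rewrite lerBlDr -lee_fin EFinD -(EFin_dot pm f01) -!massZ// -esumD.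
  - apply: le_esum => v _; rewrite -EFinD lee_fin -mulrDr ler_wpM2l//.
    by move: (fce v); rewrite ler_distl; lra.
  - by move=> v _; rewrite lee_fin.
  - by move=> v _; rewrite lee_fin pr.
rewrite -lee_fin EFinD -(EFin_dot pm f01) -!massZ// -esumD.
- apply: le_esum => v _; rewrite -EFinD lee_fin -mulrDr ler_wpM2l//.
  by move: (fce v); rewrite ler_distl; lra.
- by move=> v _; rewrite lee_fin pr.
- by move=> v _; rewrite lee_fin pr.
Qed.

Lemma spow01 (R : S -> S -> K) k u v : stochastic R -> 0 <= spow R k u v <= 1.
Proof.
move=> Rs; elim: k u => [|k IH] u /=; first by case: (_ == _); rewrite lexx ler01.
by apply: dot_ge0_le => //; exact: (Rs u).
Qed.

Lemma cvg_sum_dist {y : nat -> S -> K} {x} (r : seq S) : cvg_coordinatewise y x ->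
  \sum_(v <- r) `|y n v - x v| @[n --> \oo] --> (0 : K).
Proof.
move=> yx; elim: r => [|v r IH].
  by under eq_fun do rewrite big_nil; exact: cvg_cst.
under eq_fun do rewrite big_cons.
have yxv : `|y n v - x v| @[n --> \oo] --> (0 : K).
  rewrite -(normr0 K) -(subrr (x v)); apply: cvg_norm.
  by apply: cvgB; [exact: yx | exact: cvg_cst].
suff : `|y n v - x v| + \sum_(u <- r) `|y n u - x u| @[n --> \oo] --> (0 + 0 : K).
  by rewrite (addr0 (0 : K)).
by apply: (@cvgD K K nat \oo _ (fun n => `|y n v - x v|)); [exact: yxv|exact: IH].
Qed.

(** A finite set F carries almost all the mass of x. Outside F the distance is
    at most y + x, and the mass of y there is 1 - y(F), which is close to
    1 - x(F) because y is close to x on F. *)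
Lemma scheffe {y : nat -> S -> K} {x} : has_mass x 1 ->
  (forall n, has_mass (y n) 1) -> cvg_coordinatewise y x -> cvg_l1 y x.
Proof.
move=> x1 y1 yx; apply/fine_cvgP; split.
  apply: nearW => n; rewrite ge0_fin_numE ?esum_ge0//.
  have := (has_massD (y1 n) x1); case=> _ e.
  apply: le_lt_trans (ltry (1 + 1)); rewrite -e; apply: le_esum => v _.
  rewrite lee_fin (le_trans (ler_normB _ _))// !ger0_norm ?x1.1//.
  by case: (y1 n).
apply/cvgrPdist_le => e e0; have [F finF xF] : exists2 F : set S, finite_set F &
    ((1 - e / 4)%:E <= \sum_(v \in F) (x v)%:E)%E.
  have : ((1 - e / 4)%:E < \esum_(v in [set: S]) (x v)%:E)%E.
    by rewrite x1.2 lte_fin; lra.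
  move=> /ereal_sup_gt[_ [F [finF _] <-] /ltW xF].
  by exists F.
(* Pointwise, |y - x| + 2 x 1_F <= 2 |y - x| 1_F + (y + x): on F because
   x - y <= |y - x|, off F by the triangle inequality. *)
have key n : (\esum_(v in [set: S]) `|y n v - x v|%:E +
    2%:E * \sum_(v \in F) (x v)%:E <=
    2%:E * \sum_(v \in F) `|y n v - x v|%:E + 2%:E)%E.
  have yn0 := (y1 n).1; have x0 := x1.1.
  have [_ yx1] := has_massD (y1 n) x1.
  have inF (g : S -> K) : (forall v, 0 <= g v) -> (2%:E * \sum_(v \in F) (g v)%:E =
      \esum_(v in [set: S]) (2 * g v * (v \in F)%:R)%:E)%E.
    move=> g0; rewrite -(@esum_fset K S F (fun v => (g v)%:E) finF); last first.
      by move=> v _; rewrite lee_fin.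
    rewrite -ge0_esumZl// esum_mkcond; apply: eq_esum => v _.
    by case: (v \in F); rewrite ?mulr1 ?mulr0 ?EFinM.
  rewrite !inF// -[X in (_ <= _ + X)%E]yx1 -!esumD//; last first.
  all: try by move=> v _; rewrite lee_fin ?addr_ge0 ?mulr_ge0.
  apply: le_esum => v _; rewrite -!EFinD lee_fin.
  have := yn0 v; have := x0 v; have := ler_norm (x v - y n v).
  rewrite distrC; case: (v \in F); rewrite ?mulr1 ?mulr0 => h x0v y0v; first by lra.
  by have := ler_normB (y n v) (x v); rewrite !(ger0_norm x0v, ger0_norm y0v); lra.
have s0 : (\sum_(v \in F) `|y n v - x v|) @[n --> \oo] --> (0 : K).
  under eq_fun do rewrite fsbig_finite//=.
  exact: cvg_sum_dist.
have e4 : 0 < e / 4 by rewrite divr_gt0.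
near=> n; have := key n.
have : `|0 - \sum_(v \in F) `|y n v - x v| | <= e / 4.
  by near: n; exact: (cvgr_dist_le _ _ s0).
rewrite sub0r normrN ger0_norm; last by rewrite fsumr_ge0.
have E0 : (0 <= \esum_(v in [set: S]) `|y n v - x v|%:E)%E by exact: esum_ge0.
rewrite sub0r normrN ger0_norm; last exact: fine_ge0.
move: xF E0; rewrite !fsumEFin//=; case: (esum _ _) => [r| |]//=.
by rewrite -!EFinM -!EFinD !lee_fin => *; lra.
Unshelve. all: by end_near. Qed.

End Pairing.

(** * Cesaro means *)

Section Mean.
Context {K : realType}.
Implicit Types (x y : nat -> K).

(** The value at n averages the n terms of index less than n; at n = 0 it is 0,
    as division by 0 gives 0. Hence a bound on |x| passes to its mean at every
    index. *)
Definition mean x (n : nat) : K := (\sum_(0 <= j < n) x j) / n%:R.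

Lemma meanB x y n : mean (fun j => x j - y j) n = mean x n - mean y n.
Proof. by rewrite /mean sumrB mulrBl. Qed.

Lemma mean_le {x} {e : K} n : (forall j, `|x j| <= e) -> `|mean x n| <= e.
Proof.
move=> xe; have e0 : 0 <= e by exact: le_trans (xe 0%N).
case: n => [|n]; first by rewrite /mean big_nil mul0r normr0.
rewrite /mean normrM normfV (ger0_norm (ler0n K n.+1)).
rewrite ler_pdivrMr ?ltr0n// (le_trans (ler_norm_sum _ _ _))//.
apply: (@le_trans _ _ (\sum_(0 <= j < n.+1) e)); first exact: ler_sum.
by rewrite sumr_const_nat subn0 mulr_natr.
Qed.

Lemma cvg_mean {x} {l : K} : x n @[n --> \oo] --> l -> mean x n @[n --> \oo] --> l.
Proof.
move=> /cesaro; rewrite -(cvg_shiftS (mean x)).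
rewrite (_ : arithmetic_mean x = [sequence mean x n.+1]_n)//.
by apply/funext => n; rewrite /arithmetic_mean /mean /= mulrC.
Qed.

(** Applying the mean k times, b 0 differs by a null sequence from the k-fold
    mean of b k. A bound on b k that holds at every index survives these means,
    so it bounds the limit superior of |b 0|. *)
Lemma cvg0_mean_chain {b : nat -> nat -> K} :
  (forall k, b k n - mean (b k.+1) n @[n --> \oo] --> (0 : K)) ->
  (forall e, 0 < e -> exists k, forall n, `|b k n| <= e) ->
  b 0%N n @[n --> \oo] --> (0 : K).
Proof.
move=> b_mean b_small.
have iter_mean k m : b m n - iter k mean (b (m + k)%N) n @[n --> \oo] --> (0 : K).
  elim: k m => [|k IH] m.
    by rewrite addn0/=; under eq_fun do rewrite subrr; exact: cvg_cst.
  have /cvg_mean mIH := IH m.+1.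
  rewrite (_ : (fun n => _) = (fun n => (b m n - mean (b m.+1) n) +
      mean (fun j => b m.+1 j - iter k mean (b (m.+1 + k)%N) j) n)).
    rewrite -(addr0 (0 : K)); apply: cvgD mIH; exact: b_mean.
  by apply/funext => n; rewrite meanB addSnnS/= addrA subrK.
apply/cvgrPdist_le => e e0.
have e2 : 0 < e / 2 by rewrite divr_gt0.
have [k bk] := b_small _ e2.
have ik n : `|iter k mean (b k) n| <= e / 2.
  by elim: {1}k n => [|j IH] n //=; exact: mean_le.
near=> n.
have : `|0 - (b 0%N n - iter k mean (b k) n)| <= e / 2.
  by near: n; apply: (cvgr_dist_le _ _ (iter_mean k 0%N)).
have := ik n; rewrite !sub0r !normrN => h1 h2.
rewrite (splitr e) -[b 0%N n](subrK (iter k mean (b k) n)).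
by rewrite (le_trans (ler_normD _ _))// lerD.
Unshelve. all: by end_near. Qed.

Lemma cvg0_inv_addr {t : K} : 0 < t -> (n%:R + t)^-1 @[n --> \oo] --> (0 : K).
Proof.
move=> t0; rewrite -cvg_shiftS.
apply: (squeeze_cvgr _ (cvg_cst 0) cvg_harmonic).
apply: nearW => n /=.
have t0' := ltW t0; rewrite invr_ge0 addr_ge0//=.
by rewrite /harmonic/= lef_pV2 ?posrE ?addr_gt0 ?ltr0n// lerDl.
Qed.

(** For A_n = A0 + F_0 + ... + F_(n-1), replacing each F_j by a_j costs n times
    the mean error, and replacing n + t by n costs O(1/n) as a is bounded. The
    constant p is subtracted so that [cvg0_mean_chain] can be applied. *)
Lemma cvg0_sub_mean (A0 : K) {p t M : K} (F : nat -> K) {a : nat -> K} : 0 < t ->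
  (forall j, `|a j - p| <= M) ->
  mean (fun j => F j - a j) n @[n --> \oo] --> (0 : K) ->
  (A0 + \sum_(0 <= j < n) F j) / (n%:R + t) - p - mean (fun j => a j - p) n
    @[n --> \oo] --> (0 : K).
Proof.
move=> t0 aM D0.
have M0 : 0 <= M by exact: le_trans (aM 0%N).
apply/norm_cvg0P; apply: (@squeeze_cvgr _ _ _ _ (fun=> 0)
  (fun n => (`|A0 - t * p| + t * M) * (n%:R + t)^-1 +
     `|mean (fun j => F j - a j) n|)).
- apply: nearW => n; rewrite normr_ge0/=.
  have nt0 : 0 < n%:R + t by rewrite ltr_wpDl.
  (* An exact identity, valid at n = 0 as well, where all means vanish. *)
  have -> : (A0 + \sum_(0 <= j < n) F j) / (n%:R + t) - p -
      mean (fun j => a j - p) n = (A0 - t * p - t * mean (fun j => a j - p) n) *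
      (n%:R + t)^-1 + n%:R / (n%:R + t) * mean (fun j => F j - a j) n.
    rewrite /mean !sumrB sumr_const_nat subn0 -[p *+ n]mulr_natl.
    case: n nt0 => [|n] nt0.
      rewrite !big_nil !(subrr, oppr0, mul0r, mulr0, addr0, subr0, add0r).
      by field; rewrite (gt_eqF t0).
    have n0 : 0 < n.+1%:R :> K by rewrite ltr0n.
    move: (n.+1%:R) n0 nt0 (\sum_(_ <= _ < _) _) (\sum_(_ <= _ < _) _) => m m0 mt0 x y.
    by field; rewrite !gt_eqF.
  apply: (le_trans (ler_normD _ _)); rewrite !normrM !normfV (gtr0_norm nt0).
  apply: lerD.
    rewrite ler_wpM2r ?invr_ge0 ?(ltW nt0)// (le_trans (ler_normB _ _))// lerD2l.
    by rewrite normrM (gtr0_norm t0) ler_wpM2l ?(ltW t0)// mean_le.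
  rewrite ler_piMl// (ger0_norm (ler0n K n)) ler_pdivrMr// mul1r lerDl.
  exact: ltW.
- exact: cvg_cst.
- rewrite -(addr0 (0 : K)); apply: cvgD.
    by rewrite -(mulr0 (`|A0 - t * p| + t * M)); apply: cvgMr; exact: cvg0_inv_addr.
  by rewrite -(normr0 K); exact: cvg_norm.
Qed.

Lemma le_sum_between_squares {D : nat -> K} {c : K} (m n : nat) :
  (forall j, `|D j| <= c) -> (m ^ 2 <= n)%N -> (n < m.+1 ^ 2)%N ->
  `|\sum_(0 <= j < n) D j| <= `|\sum_(0 <= j < m ^ 2) D j| + m.*2%:R * c.
Proof.
move=> Dc mn nm; rewrite (big_cat_nat (leq0n _) mn)//=.
apply: (le_trans (ler_normD _ _)); rewrite lerD2l.
apply: (le_trans (ler_norm_sum _ _ _)).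
apply: (@le_trans _ _ (\sum_(m ^ 2 <= j < n) c)); first by apply: ler_sum.
have c0 : 0 <= c by apply: le_trans (Dc 0%N).
rewrite sumr_const_nat -[leLHS]mulr_natl ler_wpM2r// ler_nat.
by rewrite leq_subLR; move: nm; rewrite !expnS !expn0; lia.
Qed.

(** Between m^2 and (m + 1)^2 the partial sums move by at most 2 m c, which is
    negligible compared with m^2. *)
Lemma cvg_mean_of_squares {D : nat -> K} {c : K} :
  (forall j, `|D j| <= c) ->
  mean D (m.+1 ^ 2) @[m --> \oo] --> (0 : K) -> mean D n @[n --> \oo] --> (0 : K).
Proof.
rewrite /mean => Dc sq; apply/cvgrPdist_le => e e0.
have c0 : 0 <= c by apply: le_trans (Dc 0%N).
have e2 : 0 < e / 2 by rewrite divr_gt0.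
have [M1 _ HM1] := cvgr_dist_le _ _ sq _ e2.
(* Beyond M2 the displacement satisfies 2 m c / m^2 <= e / 2. *)
pose M2 := (Num.trunc (4 * c / e)).+1.
have HM2 : 4 * c / e < M2%:R by exact: truncnS_gt.
pose M := maxn M1.+1 M2.
exists (M ^ 2)%N => // n /= Mn.
(* m is the integer square root of n. *)
have [m [Mm mn nm]] : exists m, [/\ (M <= m)%N, (m ^ 2 <= n)%N & (n < m.+1 ^ 2)%N].
  have exm : exists m, (m ^ 2 <= n)%N by exists M.
  have bm m : (m ^ 2 <= n)%N -> (m <= n)%N.
    by move=> h; apply: leq_trans h; rewrite expnS expn1; nia.
  case: (ex_maxnP exm bm) => m mn mmax; exists m; split=> //.
    exact: mmax.
  by rewrite ltnNge; apply/negP => /mmax; rewrite ltnn.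
have m0 : (0 < m)%N by apply: leq_trans Mm; rewrite /M leq_max ltn0Sn.
have mr0 : 0 < m%:R :> K by rewrite ltr0n.
rewrite sub0r normrN normrM normfV (ger0_norm (ler0n K n)).
apply: (@le_trans _ _ ((`|\sum_(0 <= j < m ^ 2) D j| + m.*2%:R * c) / (m ^ 2)%:R)).
  apply: ler_pM => //; rewrite ?invr_ge0//.
    exact: le_sum_between_squares.
  by rewrite lef_pV2 ?posrE ?ltr0n ?ler_nat//; nia.
have := HM1 m.-1; rewrite /= sub0r normrN prednK// => /(_ _).
rewrite normrM normfV (ger0_norm (ler0n K (m ^ 2))) => h1.
rewrite mulrDl [leRHS](splitr e) lerD//.
  apply: h1; rewrite -ltnS prednK//; apply: leq_trans Mm; exact: leq_maxl.
rewrite natrX -muln2 natrM.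
have M2m : M2%:R <= m%:R :> K by rewrite ler_nat (leq_trans _ Mm)// leq_maxr.
have : 4 * c / e < m%:R by apply: lt_le_trans M2m.
rewrite ltr_pdivrMr// => /ltW h.
rewrite (_ : m%:R * 2 * c / m%:R ^+ 2 = 2 * c / m%:R); last first.
  by field; rewrite gt_eqF.
by rewrite ler_pdivrMr//; lra.
Qed.

End Mean.

(** * A strong law of large numbers *)

Section StrongLaw.
Context {K : realType} {d : measure_display} {Omega : measurableType d}.
Context (P : probability Omega K).

(** The bound telescopes: 1 / (m + 1)^2 <= 1 / m - 1 / (m + 1) for m >= 1. With
    the inverse of 0 equal to 0 it also holds at n = 0. *)
Lemma sum_inv_square (n : nat) :
  \sum_(0 <= m < n) (m.+1%:R ^+ 2)^-1 <= 2 - n%:R^-1 :> K.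
Proof.
elim: n => [|n IH]; first by rewrite big_nil invr0; lra.
rewrite big_nat_recr//=; case: n IH => [|n] IH.
  by rewrite big_nil expr1n invr1; lra.
rewrite (le_trans (lerD IH (lexx _)))//.
have a0 : 0 < n.+1%:R :> K by rewrite ltr0n.
rewrite -[n.+2]addn1 natrD; move: (n.+1%:R) a0 => a a0.
have a1 : 0 < a + 1 by rewrite addr_gt0.
rewrite -addrA lerD2l -subr_ge0.
rewrite (_ : _ - _ = (a * (a + 1) ^+ 2)^-1).
  by rewrite invr_ge0 mulr_ge0 ?sqr_ge0// ltW.
by field; rewrite !gt_eqF.
Qed.

Lemma bounded_integrable {f : Omega -> K} (M : K) :
  measurable_fun setT f -> (forall w, `|f w| <= M) ->
  P.-integrable setT (EFin \o f).
Proof.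
move=> mf fM; apply: measurable_bounded_integrable => //.
  by rewrite (le_lt_trans (probability_le1 _ _))// ltry.
by exists M; split=> [|x Mx w _]; [exact: num_real|exact: le_trans (fM w) (ltW Mx)].
Qed.

Context {D : nat -> Omega -> K} {c : K}.
Hypothesis mD : forall n, measurable_fun setT (D n).
Hypothesis Dc : forall n w, `|D n w| <= c.
Hypothesis ortho : forall n,
  (\int[P]_w ((\sum_(0 <= j < n) D j w) * D n w)%:E = 0)%E.

Let s n w := \sum_(0 <= j < n) D j w.

Let ms n : measurable_fun setT (s n).
Proof. exact: measurable_sum. Qed.

Let sc n w : `|s n w| <= n%:R * c.
Proof.
apply: (le_trans (ler_norm_sum _ _ _)).
rewrite -(subn0 n) mulr_natl -sumr_const_nat.
by rewrite subn0; apply: ler_sum.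
Qed.

Let c_ge0 : 0 <= c.
Proof. exact: le_trans (Dc 0%N point). Qed.

(** In the square of s (n + 1) = s n + D n the cross term integrates to 0, so
    each step adds at most c ^ 2. *)
Lemma second_moment_partial_sum n :
  (\int[P]_w (s n w ^+ 2)%:E <= (n%:R * c ^+ 2)%:E)%E.
Proof.
elim: n => [|n IH].
  under eq_integral do rewrite /s big_nil expr0n/=.
  by rewrite integral0 mul0r.
have mss : measurable_fun setT (fun w => s n w ^+ 2) by exact: measurable_funX.
have mdd : measurable_fun setT (fun w => D n w ^+ 2) by exact: measurable_funX.
have mds : measurable_fun setT (fun w => s n w * D n w) by exact: measurable_funM.
have dd w : D n w ^+ 2 <= c ^+ 2 by rewrite -(real_normK (num_real _)) lerXn2r ?nnegrE.
have ss w : s n w ^+ 2 <= (n%:R * c) ^+ 2.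
  by rewrite -(real_normK (num_real _)) lerXn2r ?nnegrE ?mulr_ge0.
have Iss : P.-integrable setT (fun w => (s n w ^+ 2)%:E).
  apply: (bounded_integrable ((n%:R * c) ^+ 2)) => // w.
  by rewrite ger0_norm ?sqr_ge0.
have Idd : P.-integrable setT (fun w => (D n w ^+ 2)%:E).
  apply: (bounded_integrable (c ^+ 2)) => // w.
  by rewrite ger0_norm ?sqr_ge0.
have Ids : P.-integrable setT (fun w => (s n w * D n w)%:E).
  apply: (bounded_integrable (n%:R * c * c)) => // w.
  by rewrite normrM ler_pM.
have -> : (\int[P]_w (s n.+1 w ^+ 2)%:E = \int[P]_w (s n w ^+ 2)%:E
    + \int[P]_w (D n w ^+ 2)%:E)%E.
  transitivity (\int[P]_w ((s n w ^+ 2)%:E +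
      ((D n w ^+ 2)%:E + ((s n w * D n w)%:E + (s n w * D n w)%:E))))%E.
    apply: eq_integral => w _; rewrite -!EFinD; congr EFin.
    by rewrite /s big_nat_recr//=; ring.
  rewrite integralD// ?integralD//; last by do 2 apply: integrableD => //.
    by rewrite ortho !adde0.
  exact: integrableD.
rewrite -natr1 mulrDl mul1r EFinD leeD//.
apply: (@le_trans _ _ (\int[P]_w (cst (c ^+ 2)%:E w))%E).
  apply: ge0_le_integral => //.
  - by move=> w _; rewrite lee_fin sqr_ge0.
  - exact/measurable_EFinP.
  - by move=> w _; rewrite lee_fin.
by rewrite integral_cst// -[leRHS]mule1 lee_wpmul2l ?lee_fin ?sqr_ge0// probability_le1.
Qed.

(** The means along the squares m^2 have second moment at most c^2 / m^2. These
    are summable, so the sum of the squared means has finite expectation; it is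
    almost surely finite and its terms tend to 0. Boundedness of D then fills
    the gaps between the squares. *)
Lemma strong_law_bounded_uncorrelated :
  {ae P, forall w, mean (D ^~ w) n @[n --> \oo] --> (0 : K)}.
Proof.
pose T m w := (s (m.+1 ^ 2) w / (m.+1 ^ 2)%:R) ^+ 2.
have T0 m w : (0 <= (T m w)%:E)%E by rewrite lee_fin sqr_ge0.
have mT m : measurable_fun setT (fun w => (T m w)%:E).
  by apply/measurable_EFinP; apply: measurable_funX; apply: measurable_funM.
have ET m : (\int[P]_w (T m w)%:E <= (c ^+ 2)%:E * ((m.+1%:R ^+ 2)^-1)%:E)%E.
  have -> : (\int[P]_w (T m w)%:E =
      (((m.+1 ^ 2)%:R ^- 2) : K)%:E * \int[P]_w (s (m.+1 ^ 2) w ^+ 2)%:E)%E.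
    rewrite -ge0_integralZl_EFin//.
    - by apply: eq_integral => w _; rewrite -EFinM /T exprMn mulrC exprVn.
    - by move=> w _; rewrite lee_fin sqr_ge0.
    - by apply/measurable_EFinP; exact: measurable_funX.
  apply: (le_trans (lee_wpmul2l _ (second_moment_partial_sum _))).
    by rewrite lee_fin invr_ge0 sqr_ge0.
  rewrite -!EFinM lee_fin natrX.
  have : 0 < m.+1%:R :> K by rewrite ltr0n.
  move: (m.+1%:R) => a a0; rewrite le_eqVlt; apply/orP; left; apply/eqP.
  by field; rewrite gt_eqF.
have : P.-integrable setT (fun w => \sum_(0 <= m <oo) (T m w)%:E)%E.
  apply/integrableP; split.
    have := @ge0_emeasurable_sum _ Omega K setT (fun m w => (T m w)%:E) xpredT.
    by apply.
  have -> : (\int[P]_w `|\sum_(0 <= m <oo) (T m w)%:E| =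
      \int[P]_w \sum_(0 <= m <oo) (T m w)%:E)%E.
    by apply: eq_integral => w _; rewrite gee0_abs// nneseries_ge0.
  rewrite integral_nneseries//.
  apply: (@le_lt_trans _ _ ((c ^+ 2)%:E * 2%:E)%E); last by rewrite -EFinM ltry.
  apply: (le_trans (lee_nneseries _ (fun m _ => ET m))).
    by move=> m _ _; exact: integral_ge0.
  rewrite nneseriesZl; last by move=> m _; rewrite lee_fin invr_ge0 sqr_ge0.
  rewrite lee_wpmul2l ?lee_fin ?sqr_ge0//.
  apply: lime_le.
    by apply: is_cvg_nneseries => m _ _; rewrite lee_fin invr_ge0 sqr_ge0.
  apply: nearW => n; rewrite sumEFin lee_fin (le_trans (sum_inv_square n))//.
  by rewrite gerDl oppr_le0 invr_ge0.
move=> /(integrable_ae measurableT).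
apply: filterS => w /(_ I) Tfin.
apply: (@cvg_mean_of_squares K (D ^~ w) c) => //.
have Tcvg : (T m w)%:E @[m --> \oo] --> 0%E.
  have tail := @nneseries_tail_cvg K (fun m => (T m w)%:E) xpredT.
  apply: (squeeze_cvge _ (cvg_cst 0%E)); last first.
    apply: tail => //; move: Tfin; rewrite ge0_fin_numE//.
    by apply: nneseries_ge0.
  apply: nearW => m; rewrite T0/=.
  have := @nneseries_lim_ge K (fun m => (T m w)%:E) xpredT m m.+1.
  by rewrite big_nat1; apply.
move/fine_cvg : Tcvg => /= Tcvg.
apply/cvgrPdist_le => e e0; near=> m.
have e0le := ltW e0; rewrite sub0r normrN -(@ler_pXn2r _ 2) ?nnegrE//=.
rewrite real_normK ?num_real//.
have : `|0 - T m w| <= e ^+ 2.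
  by near: m; apply: (cvgr_dist_le _ _ Tcvg); exact: exprn_gt0.
by rewrite sub0r normrN ger0_norm ?sqr_ge0.
Unshelve. all: by end_near. Qed.

End StrongLaw.

(** * Integration over the fibers of a countably valued map *)

Section Fibers.
Context {K : realType} {d : measure_display} {Omega : measurableType d}.
Context (mu : {measure set Omega -> \bar K}) {T : countType}.
Context {H : Omega -> T}.
Hypothesis mH : forall h, measurable (H @^-1` [set h]).

(** Indexing by [pickle] turns the fibers into a sequence of sets, as countable
    additivity requires; the indices outside the range of [pickle] give the
    empty set. *)
Let fib (m : nat) := [set w | pickle (H w) = m].

Let fibE w : fib (pickle (H w)) = H @^-1` [set H w].
Proof.
apply/seteqP; split => w' /=; first exact: (pcan_inj pickleK).
by rewrite /fib/= => ->.
Qed.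

Let mfib m : measurable (fib m).
Proof.
have [[w <-]|no] := pselect (exists w, pickle (H w) = m); first by rewrite fibE.
by rewrite (_ : fib m = set0)// -subset0 => w wm; apply: no; exists w.
Qed.

Let fib_cover : \bigcup_m fib m = setT.
Proof. by apply/seteqP; split => // w _; exists (pickle (H w)). Qed.

Let fib_triv : trivIset setT fib.
Proof. apply/trivIsetP => i j _ _ /eqP ij; apply/seteqP; split=> // w [/= wi wj].
exact: ij (etrans (esym wi) wj).
Qed.

Lemma measurable_preimage_fibers (A : set T) : measurable (H @^-1` A).
Proof.
rewrite -[X in measurable X]setIT -fib_cover setI_bigcupr.
apply: bigcup_measurable => m _.
have [[w [Aw <-]]|no] := pselect (exists w, A (H w) /\ pickle (H w) = m).
  rewrite fibE (_ : _ `&` _ = H @^-1` [set H w])//.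
  by apply/seteqP; split=> w' /= => [[]|->].
rewrite (_ : _ `&` _ = set0)// -subset0 => w [Aw wm].
by apply: no; exists w.
Qed.

Lemma measurable_fun_fibers (f : T -> K) : measurable_fun setT (f \o H).
Proof.
by move=> _ B _; rewrite setTI comp_preimage; exact: measurable_preimage_fibers.
Qed.

Lemma integral_eq0_fibers {g : Omega -> \bar K} :
  mu.-integrable setT g ->
  (forall h, (\int[mu]_(w in H @^-1` [set h]) g w = 0)%E) ->
  (\int[mu]_w g w = 0)%E.
Proof.
move=> ig g0; rewrite -fib_cover integral_bigcup ?fib_cover//.
rewrite eseries0// => m _ _.
have [[w <-]|no] := pselect (exists w, pickle (H w) = m); first by rewrite fibE.
rewrite (_ : fib m = set0) ?integral_set0//.
by rewrite -subset0 => w wm; apply: no; exists w.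
Qed.

Lemma integral_esum_fibers {A : set Omega} {f : T -> K} :
  measurable A -> (forall h, 0 <= f h) ->
  (\int[mu]_(w in A) (f (H w))%:E =
   \esum_(h in [set: T]) (f h)%:E * mu (A `&` H @^-1` [set h]))%E.
Proof.
move=> mA f0.
have mAf m : measurable (A `&` fib m) by exact: measurableI.
have AE : A = \bigcup_m (A `&` fib m) by rewrite -setI_bigcupr fib_cover setIT.
have a0 m : (0 <= \int[mu]_(w in A `&` fib m) (f (H w))%:E)%E.
  by apply: integral_ge0 => w _; rewrite lee_fin.
rewrite {1}AE ge0_integral_bigcup//; last 3 first.
- rewrite -AE; apply/measurable_EFinP.
  by apply: (measurable_funS measurableT) => //; exact: measurable_fun_fibers.
- by move=> w _; rewrite lee_fin.
- apply/trivIsetP => i j _ _ /eqP ij; apply/seteqP; split=> // w.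
  by move=> [[_ /= wi] [_ /= wj]]; exact: ij (etrans (esym wi) wj).
rewrite nneseries_esumT//.
set a := (fun m => \int[mu]_(w in A `&` fib m) (f (H w))%:E)%E.
transitivity (\esum_(m in range (@pickle T)) a m)%E.
  rewrite [RHS]esum_mkcond; apply: eq_esum => m _.
  case: ifPn => // /negP; rewrite inE => no.
  rewrite /a (_ : fib m = set0) ?setI0 ?integral_set0//.
  by rewrite -subset0 => w wm; apply: no; exists (H w).
rewrite (@reindex_esum _ T nat setT (range (@pickle T)) pickle); last first.
  by split=> [h _|h h' _ _|//]; [exists h|exact: (pcan_inj pickleK)].
apply: eq_esum => h _; rewrite /a.
have -> : fib (pickle h) = H @^-1` [set h].
  by apply/seteqP; split => w /=; [exact: (pcan_inj pickleK)|rewrite /fib/= => ->].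
rewrite -integral_cst; last exact: measurableI.
by apply: eq_integral => w; rewrite inE => -[_ /= ->].
Qed.

End Fibers.

(** * The history of the draws *)

Section History.
Context {S : countType}.

Fixpoint history {T : Type} (Z : nat -> T -> S) (n : nat) (w : T) : seq S :=
  if n is m.+1 then Z m w :: history Z m w else [::].

Lemma history_inj {T : Type} {Z : nat -> T -> S} {n w w' k} :
  history Z n w = history Z n w' -> (k < n)%N -> Z k w = Z k w'.
Proof.
elim: n => [//|n IH] /= [Zn hn]; rewrite ltnS leq_eqVlt => /predU1P[->//|].
exact: IH.
Qed.

(** The domain is an arbitrary measurable space so that the lemma applies both
    to the ambient sigma-algebra and to the one generated by the past. *)
Lemma measurable_history {d : measure_display} {T : measurableType d}
    (Z : nat -> T -> S) n h :
  (forall k A, (k < n)%N -> measurable (Z k @^-1` A)) ->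
  measurable (history Z n @^-1` [set h]).
Proof.
elim: n h => [|n IH] h mZ.
  have [->|h0] := eqVneq h [::].
    by rewrite (_ : _ @^-1` _ = setT)//; apply/seteqP; split.
  rewrite (_ : _ @^-1` _ = set0)// -subset0 => w /= e.
  by move: h0; rewrite -e eqxx.
case: h => [|z h].
  by rewrite (_ : _ @^-1` _ = set0)// -subset0 => w /=.
rewrite (_ : _ @^-1` _ = (Z n @^-1` [set z]) `&` (history Z n @^-1` [set h])).
  apply: measurableI; first exact: mZ.
  by apply: IH => k A kn; apply: mZ; exact: ltnW.
by apply/seteqP; split => w /= [] => [-> ->|-> ->].
Qed.

End History.

(** * Draw errors in the urn process *)

Section UrnProcess.
Context {K : realType} {S : countType} {R : S -> S -> K}.
Context {U0 : S -> K} {t : K} {d : measure_display} {Omega : measurableType d}.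
Context {P : probability Omega K}.
Context {U : nat -> Omega -> S -> K} {Z : nat -> Omega -> S}.
Hypothesis R_stochastic : stochastic R.
Hypothesis U0_mass : has_mass U0 t.
Hypothesis t_gt0 : 0 < t.
Hypothesis urn : urn_process P R U0 t U Z.

Lemma urnE n w : U n w = fun v => U0 v + \sum_(0 <= j < n) R (Z j w) v.
Proof.
apply/funext => v; elim: n => [|n IH].
  by rewrite big_nil addr0 (urn_init urn).
by rewrite (urn_step urn) IH big_nat_recr//= addrA.
Qed.

Lemma urn_mass n w : has_mass (U n w) (n%:R + t).
Proof.
have := has_massD U0_mass
  (has_mass_sum n (fun j => R_stochastic (Z j w))).
by rewrite sumr_const_nat subn0 addrC -urnE.
Qed.

Let nt_gt0 n : 0 < n%:R + t.
Proof. by rewrite ltr_wpDl. Qed.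

Lemma urn_config_mass n w : has_mass (fun v => U n w v / (n%:R + t)) 1.
Proof.
have := has_mass_divr (ltW (nt_gt0 n)) (urn_mass n w).
by rewrite divff// gt_eqF.
Qed.

Section Observable.
Variable f : S -> K.
Hypothesis f01 : forall v, 0 <= f v <= 1.

Lemma urn_dot n w :
  dot (U n w) f = dot U0 f + \sum_(0 <= j < n) dot (R (Z j w)) f.
Proof.
elim: n => [|n IH].
  by rewrite big_nil addr0 urnE; congr dot; apply/funext => v; rewrite big_nil addr0.
rewrite (_ : U n.+1 w = fun v => U n w v + R (Z n w) v); last first.
  by apply/funext => v; rewrite (urn_step urn).
rewrite (dotD (urn_mass n w) (R_stochastic _))//.
by rewrite IH big_nat_recr//= addrA.
Qed.

(** The conditional mean of f (Z n) given the past. *)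
Definition draw_mean n w := dot (U n w) f / (n%:R + t).

Lemma draw_mean01 n w : 0 <= draw_mean n w <= 1.
Proof.
have /andP[h0 h1] := dot_ge0_le (urn_mass n w) f01.
by rewrite /draw_mean divr_ge0 ?(ltW (nt_gt0 n))//= ler_pdivrMr// mul1r.
Qed.

Definition draw_error n w := f (Z n w) - draw_mean n w.

Lemma draw_error_le1 n w : `|draw_error n w| <= 1.
Proof.
have /andP[a b] := draw_mean01 n w; have /andP[a' b'] := f01 (Z n w).
by rewrite ler_norml /draw_error; apply/andP; split; lra.
Qed.

Let mZ n h : measurable (Z n @^-1` [set h]).
Proof. exact: (urn_draw_measurable urn). Qed.

Lemma measurable_draw_mean n : measurable_fun setT (draw_mean n).
Proof.
rewrite /draw_mean; under eq_fun do rewrite urn_dot.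
apply: measurable_funM => //; apply: measurable_funD => //.
apply: measurable_sum => j.
exact: (measurable_fun_fibers (mZ j) (fun z => dot (R z) f)).
Qed.

Lemma measurable_draw_error n : measurable_fun setT (draw_error n).
Proof.
apply: measurable_funB; last exact: measurable_draw_mean.
exact: (measurable_fun_fibers (mZ n) f).
Qed.

Let mhist n h : measurable (history Z n @^-1` [set h]).
Proof. by apply: measurable_history => k A _; exact: (urn_draw_measurable urn). Qed.

Lemma urn_past_history n h : urn_past U Z n (history Z n @^-1` [set h]).
Proof.
set G := [set E | (exists k (A : set S), (k < n)%N /\ E = Z k @^-1` A) \/
   (exists k v (B : set K), [/\ (k <= n)%N, measurable B &
      E = (fun w => U k w v) @^-1` B])].
apply: (@measurable_history S _ (g_sigma_algebraType G)) => k A kn.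
by apply: sub_gen_smallest; left; exists k, A.
Qed.

Lemma urn_eq_draws n w w' :
  (forall j, (j < n)%N -> Z j w = Z j w') -> U n w = U n w'.
Proof.
move=> e; rewrite !urnE; apply/funext => v; congr (_ + _).
by apply: eq_big_nat => j /andP[_ jn]; rewrite e.
Qed.

(** The draw errors are martingale differences. On an atom A of the history
    U_n is a constant vector, so the draw rule gives
    P (A, Z_n = z) = U_n(z) / (n + t) * P A; multiplying by f z and summing over
    z yields the integral over A of the conditional mean. *)
Lemma integral_draw_error_history n h :
  (\int[P]_(w in history Z n @^-1` [set h]) (draw_error n w)%:E = 0)%E.
Proof.
set A := history Z n @^-1` [set h].
have mA : measurable A by exact: mhist.
have [[w0 Aw0]|no] := pselect (exists w, A w); last first.
  rewrite (_ : A = set0) ?integral_set0// -subset0 => w Aw.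
  by apply: no; exists w.
have UA w : A w -> U n w = U n w0.
  by move=> Aw; apply: urn_eq_draws => j; apply: history_inj; rewrite Aw Aw0.
have PAfin : (P A \is a fin_num) by exact: fin_num_measure.
have mean_cst : (\int[P]_(w in A) (draw_mean n w)%:E =
    (draw_mean n w0)%:E * P A)%E.
  rewrite -integral_cst//; apply: eq_integral => w; rewrite inE => Aw.
  by rewrite /draw_mean UA.
have draw : (\int[P]_(w in A) (f (Z n w))%:E = (draw_mean n w0)%:E * P A)%E.
  rewrite (integral_esum_fibers P (mZ n) mA); last first.
    by move=> z; case/andP: (f01 z).
  have PAz z : (P (A `&` Z n @^-1` [set z]) =
      (U n w0 z / (n%:R + t))%:E * P A)%E.
    have [_ _ <-] := urn_draw urn n z; last exact: urn_past_history.
    rewrite -integral_cst//; apply: eq_integral => w; rewrite inE => Aw.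
    by rewrite UA.
  have PA0 : 0 <= fine (P A) by exact: fine_ge0.
  have -> : (\esum_(z in [set: S]) (f z)%:E * P (A `&` Z n @^-1` [set z]) =
      \esum_(z in [set: S])
        (fine (P A) / (n%:R + t))%:E * (U n w0 z * f z)%:E)%E.
    apply: eq_esum => z _; rewrite PAz -(fineK PAfin) -!EFinM.
    by congr EFin; ring.
  rewrite ge0_esumZl.
  - rewrite (EFin_dot (urn_mass n w0) f01) -(fineK PAfin) -!EFinM.
    by congr EFin; rewrite /draw_mean; ring.
  - by rewrite divr_ge0// ltW.
  - move=> z; rewrite lee_fin mulr_ge0//; first exact: (urn_mass n w0).1.
    by case/andP: (f01 z).
have integrable_A (g : Omega -> K) : measurable_fun setT g ->
    (forall w, 0 <= g w <= 1) -> P.-integrable A (EFin \o g).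
  move=> mg g01; apply: (integrableS measurableT) => //.
  apply: (bounded_integrable P 1) => // w.
  by have /andP[g0 g1] := g01 w; rewrite ger0_norm.
rewrite /draw_error; under eq_integral do rewrite EFinB.
rewrite integralB//.
- by rewrite draw mean_cst subee// fin_numM.
- apply: (integrable_A (f \o Z n)) => [|w]; last exact: f01.
  exact: (measurable_fun_fibers (mZ n) f).
- apply: (integrable_A (draw_mean n)) => [|w]; last exact: draw_mean01.
  exact: measurable_draw_mean.
Qed.

(** The sum of the previous errors is a function of the history, hence constant
    on each of its atoms, where the current error has integral 0. *)
Lemma draw_error_uncorrelated n :
  (\int[P]_w ((\sum_(0 <= j < n) draw_error j w) * draw_error n w)%:E = 0)%E.
Proof.
have integrable_error : P.-integrable setT (EFin \o draw_error n).
  apply: (bounded_integrable P 1); first exact: measurable_draw_error.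
  exact: draw_error_le1.
apply: (integral_eq0_fibers P (mhist n)).
  apply: (bounded_integrable P n%:R) => [|w].
    apply: measurable_funM; last exact: measurable_draw_error.
    by apply: measurable_sum => j; exact: measurable_draw_error.
  rewrite normrM -[leRHS]mulr1 ler_pM ?draw_error_le1//.
  apply: (le_trans (ler_norm_sum _ _ _)).
  apply: (@le_trans _ _ (\sum_(0 <= j < n) 1)).
    by apply: ler_sum => j _; exact: draw_error_le1.
  by rewrite sumr_const_nat subn0.
move=> h; have [[w0 hw0]|no] := pselect (exists w, history Z n w = h); last first.
  rewrite (_ : _ @^-1` _ = set0) ?integral_set0// -subset0 => w hw.
  by apply: no; exists w.
have sum_cst w : history Z n w = h ->
    \sum_(0 <= j < n) draw_error j w = \sum_(0 <= j < n) draw_error j w0.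
  rewrite -hw0 => e; apply: eq_big_nat => j /andP[_ jn].
  rewrite /draw_error /draw_mean (history_inj e jn).
  rewrite (urn_eq_draws j w w0)// => k kj.
  by apply: history_inj e _; exact: ltn_trans jn.
transitivity (\int[P]_(w in history Z n @^-1` [set h])
    ((\sum_(0 <= j < n) draw_error j w0)%:E * (draw_error n w)%:E))%E.
  by apply: eq_integral => w; rewrite inE => hw; rewrite EFinM sum_cst.
rewrite integralZl//; last exact: integrableS integrable_error.
by rewrite integral_draw_error_history mule0.
Qed.

Lemma draw_error_mean_cvg0 :
  {ae P, forall w, mean (fun j => draw_error j w) n @[n --> \oo] --> (0 : K)}.
Proof.
apply: (@strong_law_bounded_uncorrelated _ _ _ P draw_error 1).
- exact: measurable_draw_error.
- exact: draw_error_le1.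
- exact: draw_error_uncorrelated.
Qed.

End Observable.

Lemma draw_mean_dirac v n w :
  draw_mean (spow R 0 ^~ v) n w = U n w v / (n%:R + t).
Proof. by rewrite /draw_mean dot_dirac//; exact: (urn_mass n w).1. Qed.

(** * Convergence along a path with vanishing mean errors *)

Section Path.
Variables (pi : S -> K) (w : Omega).
Hypothesis pi_ge0 : forall v, 0 <= pi v.
Hypothesis R_uniformly_ergodic : uniformly_ergodic R pi.
Hypothesis errors_cvg0 : forall v k,
  mean (fun j => draw_error (spow R k ^~ v) j w) n @[n --> \oo] --> (0 : K).

(** The chain of [cvg0_mean_chain] is b k n = a_n(R^k(., v)) - pi_v, where a_n is
    the average against the normalized configuration at time n. *)
Lemma urn_config_cvg v : U n w v / (n%:R + t) @[n --> \oo] --> pi v.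
Proof.
pose f k := spow R k ^~ v.
have f01 k u : 0 <= f k u <= 1 by exact: spow01.
pose b k n := draw_mean (f k) n w - pi v.
suff b0 : b 0%N n @[n --> \oo] --> (0 : K).
  have : b 0%N n + pi v @[n --> \oo] --> 0 + pi v.
    by apply: cvgD b0 _; exact: cvg_cst.
  rewrite add0r /b; under eq_fun do rewrite subrK draw_mean_dirac.
  exact.
apply: cvg0_mean_chain => [k|e e0].
  have bM j : `|draw_mean (f k.+1) j w - pi v| <= 1 + pi v.
    have /andP[m0 m1] := draw_mean01 (f k.+1) (f01 _) j w.
    by have := pi_ge0 v; rewrite ler_norml => *; apply/andP; split; lra.
  have := cvg0_sub_mean (dot U0 (f k)) (fun j => f k.+1 (Z j w)) t_gt0 bM
    (errors_cvg0 v k.+1).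
  by under eq_fun do rewrite -urn_dot//.
have [rho [C [rho0 rho1 C0 ergodic]]] := R_uniformly_ergodic.
have : C * rho ^+ n @[n --> \oo] --> (0 : K).
  by rewrite -(mulr0 C); apply: cvgMr; apply: cvg_expr; rewrite gtr0_norm.
move=> /cvgrPdist_le/(_ _ e0)[N _ HN].
(* The ergodic estimate starts at power 1, whence N.+1 instead of N. *)
exists N.+1 => n.
have CN0 m : 0 <= C * rho ^+ m by rewrite mulr_ge0 ?exprn_ge0 ?ltW.
have := dot_dist (urn_mass n w) (f01 N.+1) (pi_ge0 v)
  (CN0 N.+1) (fun u => ergodic N.+1 u v isT).
have -> : b N.+1 n = (dot (U n w) (f N.+1) - (n%:R + t) * pi v) / (n%:R + t).
  by rewrite /b /draw_mean mulrBl [_ * pi v]mulrC mulfK// gt_eqF.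
rewrite normrM normfV (gtr0_norm (nt_gt0 n)) ler_pdivrMr// => h.
apply: (le_trans h); rewrite mulrC ler_wpM2r ?(ltW (nt_gt0 n))//.
have := HN N.+1 (leqnSn N); rewrite /= sub0r normrN ger0_norm//.
Qed.

Lemma draw_frequency_cvg v :
  (num_draws Z n w v)%:R / n.+1%:R @[n --> \oo] --> pi v.
Proof.
pose f := spow R 0 ^~ v.
have mean_cvg : mean (fun j => draw_mean f j w) n @[n --> \oo] --> pi v.
  apply: cvg_mean; under eq_fun do rewrite draw_mean_dirac; exact: urn_config_cvg.
have : mean (fun j => f (Z j w)) n @[n --> \oo] --> pi v.
  rewrite -(add0r (pi v)) (_ : mean _ = fun n =>
    mean (fun j => draw_error f j w) n + mean (fun j => draw_mean f j w) n).
    by apply: cvgD mean_cvg; exact: errors_cvg0.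
  by apply/funext => n; rewrite meanB subrK.
rewrite -cvg_shiftS (_ : [sequence mean _ n.+1]_n =
  fun n => (num_draws Z n w v)%:R / n.+1%:R)//.
by apply/funext => n; rewrite /= /mean /num_draws natr_sum.
Qed.

Lemma draw_frequency_mass n :
  has_mass (fun v => (num_draws Z n w v)%:R / n.+1%:R) (1 : K).
Proof.
have := has_mass_divr (ler0n K n.+1) (has_mass_sum n.+1
  (fun j => has_mass_dirac (Z j w))).
rewrite sumr_const_nat subn0 divff ?pnatr_eq0//.
by congr has_mass; apply/funext => v; rewrite /num_draws natr_sum.
Qed.

End Path.
End UrnProcess.

(** * The limit theorem *)

Theorem theorem1p2 (K : realType) (S : countType)
  (S_infinite : infinite_set [set: S])
  (R : S -> S -> K) (pi : S -> K)
  (R_stochastic : stochastic R)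
  (R_irreducible : irreducible R)
  (R_aperiodic : aperiodic R)
  (R_positive_recurrent : positive_recurrent R)
  (pi_stationary : stationary R pi)
  (R_uniformly_ergodic : uniformly_ergodic R pi)
  (U0 : S -> K) (t : K)
  (U0_ge0 : forall v, 0 <= U0 v)
  (t_def : (\esum_(v in [set: S]) (U0 v)%:E = t%:E)%E)
  (t_gt0 : 0 < t)
  (d : measure_display) (Omega : measurableType d) (P : probability Omega K)
  (U : nat -> Omega -> S -> K) (Z : nat -> Omega -> S)
  (urn : urn_process P R U0 t U Z) :
  {ae P, forall w,
     cvg_coordinatewise (fun n v => U n w v / (n%:R + t)) pi /\
     cvg_l1 (fun n v => U n w v / (n%:R + t)) pi} /\
  {ae P, forall w,
     cvg_coordinatewise (fun n v => (num_draws Z n w v)%:R / (n.+1)%:R) pi /\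
     cvg_l1 (fun n v => (num_draws Z n w v)%:R / (n.+1)%:R) pi}.
Proof.
have U0_mass : has_mass U0 t by [].
have [pi_mass _] := pi_stationary.
pose errors_cvg0 w v k := mean
  (fun j => @draw_error _ _ t _ _ U Z (spow R k ^~ v) j w) n @[n --> \oo] --> (0 : K).
have ae_errors : {ae P, forall w v k, errors_cvg0 w v k}.
  (* Almost sure events are intersected along nat: m runs over codes of
     elements v of S. *)
  suff : {ae P, forall w, forall m k v, unpickle m = Some v -> errors_cvg0 w v k}.
    apply: filterS => w ew v k; apply: (ew (pickle v)); exact: pickleK.
  apply: ae_foralln => m; apply: ae_foralln => k.
  case: (unpickle m) => [v|]; last by apply: aeW.
  have := draw_error_mean_cvg0 R_stochastic U0_mass t_gt0 urn (spow R k ^~ v).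
  move=> /(_ (fun u => spow01 R k u v R_stochastic)).
  by apply: filterS => w ew _ [<-].
split; apply: filterS ae_errors => w errors.
- have cvg_U := urn_config_cvg R_stochastic U0_mass t_gt0 urn pi w pi_mass.1
    R_uniformly_ergodic errors.
  split; first exact: cvg_U.
  apply: scheffe cvg_U => //.
  by move=> n; exact: (urn_config_mass R_stochastic U0_mass t_gt0 urn n w).
- have cvg_N := draw_frequency_cvg R_stochastic U0_mass t_gt0 urn pi w pi_mass.1
    R_uniformly_ergodic errors.
  split; first exact: cvg_N.
  by apply: scheffe cvg_N => // n; exact: draw_frequency_mass.
Qed.
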